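(* Let $\alpha,a\in\mathbb{R}$ and let $l,\mu\ge 0$ be integers. The generating function $Q(x,y;\alpha,-a)$ can be summed in closed form: $$w_l(x)\,Q(x,y;\alpha,-a)=\sigma(x)^{-l}\sum_{\nu=0}^{\infty}\frac{(y\sigma(x))^{\nu}}{\nu!}\frac{d^{\nu}}{dx^{\nu}}\left(\sigma(x)^{-(a+1)}e^{-\alpha\cot^{-1}x}\right),$$ $$Q(x,y;\alpha,-a)=(1+x^2)^{a+1}e^{\alpha\cot^{-1}x}\,\bigl[1+(x+y(1+x^2))^2\bigr]^{-(a+1)}e^{-\alpha\cot^{-1}(x+y(1+x^2))}.$$ Moreover, $$\frac{\partial^{\mu}}{\partial y^{\mu}}\left(w_l(x)\sigma(x)^{l}Q(x,y;\alpha,-a)\right)=\sigma(x)^{\mu}\sum_{\nu=\mu}^{\infty}\frac{(y\sigma(x))^{\nu-\mu}}{(\nu-\mu)!}\frac{d^{\nu-\mu}}{dx^{\nu-\mu}}\left(\sigma(x)^{-(a+\mu+1)}e^{-\alpha\cot^{-1}x}Q^{(\alpha,-a)}_{\mu}(x)\right),$$ $$\frac{\partial^{\mu}Q(x,y;\alpha,-a)}{\partial y^{\mu}}=w_l(x)^{-1}\sigma(x)^{\mu-l}\bigl[1+(x+y\sigma(x))^2\bigr]^{-(a+\mu+1)}e^{-\alpha\cot^{-1}(x+y\sigma(x))}\,Q^{(\alpha,-a)}_{\mu}(x+y\sigma(x)).$$ Both Taylor series (the sums over $\nu$ in the first and third formulas) converge if $x$ and $x+y\sigma(x)$ are regular points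 of the weight function.
   Context: Throughout $x$ is a real variable, $\alpha,a$ are real parameters, $\sigma(x)=1+x^2$, and $\cot^{-1}:\mathbb{R}\to(0,\pi)$ is the smooth branch, so that $\frac{d}{dx}\cot^{-1}x=-1/\sigma(x)$. For integers $l\ge 0$ the weight functions are $w_l(x)=\sigma(x)^{-(l+a+1)}e^{-\alpha\cot^{-1}x}=\sigma(x)^{-l}w_0(x)$. Define $P_l^{(a,\alpha)}(x)=\frac{1}{w_l(x)}\frac{d^l}{dx^l}[w_l(x)\sigma(x)^l]=\frac{\sigma(x)^l}{w_0(x)}\frac{d^l w_0(x)}{dx^l}$. The complementary (Romanovski) polynomials $Q_\nu^{(\alpha,-a)}$, with $Q_0^{(\alpha,-a)}\equiv 1$, are defined by the Rodrigues representation $P_l^{(a,\alpha)}(x)=\frac{1}{w_l(x)}\frac{d^{l-\nu}}{dx^{l-\nu}}[\sigma(x)^{l-\nu}w_l(x)Q_\nu^{(\alpha,-a)}(x)]$ for all integers $0\le\nu\le l$ (the case $l=\nu$ reads $Q_\nu^{(\alpha,-a)}=P_\nu^{(a,\alpha)}$). The second upper index is minus the parameter $a$ of the weight. The generating function is defined as $Q(x,y;\alpha,-a)=\sum_{\nu=0}^{\infty}\frac{y^{\nu}}{\nu!}Q^{(\alpha,-a)}_{\nu}(x)$.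
   Formalization: Regularity of only x and x+yσ(x) does not give convergence (α=a=x=0, y=2 diverges); the formal theorem assumes that all complex points within |yσ(x)| of x are regular for the weight: |y|√(1+x²)<1, or any y if the weight is a polynomial. *)

(* Defs.v *)
From Stdlib Require Import Reals Factorial.
From Coquelicot Require Import Coquelicot.
Open Scope R_scope.

(* Not called [sigma], a name taken by the standard library. *)
Definition wsigma (x : R) : R := 1 + x ^ 2.

(* The branch with values in (0, PI), smooth on all of R. *)
Definition arccot (x : R) : R := PI / 2 - atan x.

Definition weight (a alpha : R) (l : nat) (x : R) : R :=
  Rpower (wsigma x) (- (INR l + a + 1)) * exp (- alpha * arccot x).

Definition romanovski_P (a alpha : R) (l : nat) (x : R) : R :=
  / weight a alpha l x
  * Derive_n (fun t => weight a alpha l t * wsigma t ^ l) l x.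

(* The Rodrigues representation determines [Q nu] (take [l = nu]), so this
   predicate holds of exactly one family up to pointwise equality, namely
   [romanovski_P a alpha].  [Q nu] is written Q_nu^(alpha, -a), with the sign
   of [a] reversed. *)
Definition is_complementary (a alpha : R) (Q : nat -> R -> R) : Prop :=
  (forall x : R, Q 0%nat x = 1) /\
  (forall (l nu : nat) (x : R), (nu <= l)%nat ->
     romanovski_P a alpha l x =
     / weight a alpha l x
     * Derive_n (fun t => wsigma t ^ (l - nu) * weight a alpha l t * Q nu t)
                (l - nu) x).

Definition generating_function (Q : nat -> R -> R) (x y : R) : R :=
  Series (fun nu => y ^ nu / INR (fact nu) * Q nu x).

(* Reindexes the terms [u nu], [nu >= m], of a series starting at [m]. *)
Definition from (m : nat) (u : nat -> R) : nat -> R := fun k => u (m + k)%nat.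

(* Since exp (- alpha * arccot z) continues to
   (z + i)^(i alpha/2) (z - i)^(- i alpha/2), the weight
   sigma^-(a+1) exp (- alpha * arccot) continues to a product of powers of
   z - i and z + i with exponents -(a+1) - i alpha/2 and -(a+1) + i alpha/2.
   Hence its only possible finite singular points are the roots i, -i of
   1 + z^2, and they are regular exactly when both exponents are one and the
   same natural number, that is, when the weight is a polynomial. *)
Definition weight_regular_at (a alpha : R) (z : C) : Prop :=
  (1 + z * z)%C <> 0%C \/
  (alpha = 0 /\ exists n : nat, - (a + 1) = INR n).

(* [x] and [x + y * wsigma x] lie in a disc about [x] of regular points in the
   complex plane.  Regularity of the two real end points alone would be no
   restriction, and would not imply convergence of the Taylor series about [x]
   (alpha = a = x = 0 gives the sum of (-1)^k y^(2k)). *)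
Definition regular_displacement (a alpha x y : R) : Prop :=
  forall z : C, Cmod (z - RtoC x)%C <= Rabs (y * wsigma x) ->
    weight_regular_at a alpha z.

(* Main.v *)
Require Import Defs.
From Stdlib Require Import Reals Factorial Lra Lia.
From Coquelicot Require Import Coquelicot.
Open Scope R_scope.

(** Since [w_l sigma^l = w_0], the Rodrigues representation with [l = nu] reads
    [Q nu = sigma^nu w_0^(nu) / w_0].  The generating function is therefore
    [1 / w_0 x] times the Taylor series of [w_0] about [x], taken at the
    displacement [y * sigma x], and the factor
    [sigma^-(a+mu+1) exp (- alpha * arccot) Q mu] of the last two formulas is
    [w_0^(mu)].  Once it is known that [w_0] is the sum of its Taylor series on
    an interval that contains the displacement, every formula follows by
    differentiating a power series term by term and by powers of [sigma]
    cancelling ([taylor_series_Derive_n], [is_derive_n_rescaled]).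

    The analytic content is thus the convergence of that Taylor series for all
    displacements [k] smaller than the distance [sqrt (sigma x)] from [x] to the
    singular points [i] and [-i].  It is obtained on the real line from the
    Pearson equation [sigma w_0' = (alpha - 2 (a + 1) x) w_0].  About [x] this is
    the linear equation [(sigma x + 2 x k + k^2) u' = (b + g k) u], whose formal
    solution has coefficients given by a three-term recurrence.  The recurrence
    is a perturbation of order [1/n] of one with constant coefficients, which
    contracts a definite quadratic form of two consecutive coefficients by
    exactly [1 / sigma x] ([ode_energy_step]).  So the radius of convergence is at
    least [sqrt (sigma x)] ([CV_radius_ode_coef]), the sum solves the equation
    ([ode_coef_ode]), and it agrees with [w_0] because a linear equation of the
    first order determines its solution up to a factor ([linear_ode_unique]).

    If the disc does contain [i] or [-i], the hypothesis of regularity leaves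
    only the case in which [w_0] is a power of [sigma], whose expansion
    converges everywhere ([power_expansion_wsigma_pow]). *)

(** * Functions that are sums of power series *)

Definition power_expansion (f : R -> R) (x r : R) (c : nat -> R) : Prop :=
  forall k, Rabs k < r -> is_pseries c k (f (x + k)).

(** Pointwise summability on an open interval already controls the radius, as a
    series cannot converge beyond it. *)
Lemma power_expansion_CV_radius f x r c k :
  power_expansion f x r c -> Rabs k < r -> Rbar_lt (Rabs k) (CV_radius c).
Proof.
  intros Hf Hk.
  pose proof (Rabs_pos k) as Hk0.
  destruct (Rbar_lt_le_dec (CV_radius c) ((Rabs k + r) / 2)) as [Hlt | Hle].
  - exfalso.
    assert (Hm : Rabs ((Rabs k + r) / 2) = (Rabs k + r) / 2)
      by (apply Rabs_pos_eq; lra).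
    apply (CV_disk_outside c ((Rabs k + r) / 2)).
    + now rewrite Hm.
    + apply ex_series_lim_0.
      eexists. apply is_pseries_R, Hf. rewrite Hm. lra.
  - apply Rbar_lt_le_trans with (2 := Hle). simpl. lra.
Qed.

Lemma locally_Rabs_lt k r : Rabs k < r -> locally k (fun t => Rabs t < r).
Proof.
  intros Hk. assert (Hd : 0 < r - Rabs k) by lra.
  exists (mkposreal _ Hd).
  refine (fun (t : R) (Ht : Rabs (t - k) < r - Rabs k) => _).
  pose proof (Rabs_triang (t - k) k) as Htri.
  replace (t - k + k) with t in Htri by ring. lra.
Qed.

Lemma is_derive_n_power_expansion f x r c m k :
  power_expansion f x r c -> Rabs k < r ->
  is_derive_n f m (x + k) (PSeries (PS_derive_n m c) k).
Proof.
  intros Hf Hk.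
  apply is_derive_n_ext_loc with (fun t => PSeries c (t + - x)).
  - assert (Hcont : continuous (fun t : R => t + - x) (x + k))
      by (apply (continuous_plus (fun t : R => t) (fun _ => - x));
          [apply continuous_id | apply continuous_const]).
    apply (filter_imp (fun t => Rabs (t + - x) < r)).
    + intros t Ht. rewrite (is_pseries_unique _ _ _ (Hf _ Ht)). f_equal. ring.
    + apply (Hcont (fun t => Rabs t < r)), locally_Rabs_lt.
      now replace (x + k + - x) with k by ring.
  - apply is_derive_n_comp_trans.
    replace (x + k + - x) with k by ring.
    apply is_derive_n_PSeries.
    now apply power_expansion_CV_radius with (1 := Hf).
Qed.

Lemma Derive_n_power_expansion f x r c m k :
  power_expansion f x r c -> Rabs k < r ->
  is_derive_n f m (x + k) (Derive_n f m (x + k)).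
Proof.
  intros Hf Hk.
  pose proof (is_derive_n_power_expansion f x r c m k Hf Hk) as H.
  now rewrite (is_derive_n_unique _ _ _ _ H).
Qed.

Lemma taylor_series_Derive_n f x r c m k :
  power_expansion f x r c -> Rabs k < r ->
  is_series (fun n => k ^ n / INR (fact n) * Derive_n f (n + m) x)
            (Derive_n f m (x + k)).
Proof.
  intros Hf Hk.
  rewrite (is_derive_n_unique _ _ _ _
             (is_derive_n_power_expansion f x r c m k Hf Hk)).
  assert (Hr0 : Rabs 0 < r)
    by (rewrite Rabs_R0; apply Rle_lt_trans with (2 := Hk), Rabs_pos).
  apply is_series_ext with (fun n => PS_derive_n m c n * k ^ n).
  - intros n.
    rewrite <- (Rplus_0_r x) at 1.
    rewrite (is_derive_n_unique _ _ _ _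
               (is_derive_n_power_expansion f x r c (n + m) 0 Hf Hr0)).
    rewrite PSeries_0. unfold PS_derive_n. simpl. field.
    apply INR_fact_neq_0.
  - apply is_pseries_R, PSeries_correct, CV_radius_inside.
    rewrite CV_radius_derive_n.
    now apply power_expansion_CV_radius with (1 := Hf).
Qed.

(** The form in which expansions are used: replacing [k] by [y * s] turns the
    [m]-th derivative into [s^m] times the derivative of [f]. *)
Lemma is_derive_n_rescaled f x r c s m y :
  power_expansion f x r c -> Rabs (y * s) < r ->
  is_derive_n (fun y' => f (x + y' * s)) m y (s ^ m * Derive_n f m (x + y * s)).
Proof.
  intros Hf Hy.
  assert (Hnear : forall k, Rabs k < r -> forall n,
            is_derive_n (fun t => f (t + x)) n k (Derive_n f n (x + k))).
  { intros k Hk n. rewrite (Rplus_comm x k).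
    apply is_derive_n_comp_trans. rewrite (Rplus_comm k x).
    now apply Derive_n_power_expansion with (1 := Hf). }
  rewrite (Rmult_comm y) in *.
  apply is_derive_n_ext_loc with (fun y' => f (s * y' + x)).
  - apply filter_forall. intros y'. f_equal. ring.
  - apply (is_derive_n_comp_scal (fun t => f (t + x))).
    + apply filter_imp with (2 := locally_Rabs_lt _ _ Hy). intros k Hk n _.
      destruct n as [|n]; [exact I|]. eexists. exact (Hnear k Hk (S n)).
    + now apply Hnear.
Qed.

(** * Powers of sigma *)

Lemma wsigma_pos x : 0 < wsigma x.
Proof. unfold wsigma. nra. Qed.

Lemma power_expansion_wsigma_mult f x r c :
  power_expansion f x r c ->
  exists c', power_expansion (fun t => wsigma t * f t) x r c'.
Proof.
  intros Hf.
  (* The product with [wsigma (x + k) = wsigma x + 2 x k + k^2]. *)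
  exists (PS_plus (PS_scal (wsigma x) c)
            (PS_plus (PS_scal (2 * x) (PS_incr_1 c)) (PS_incr_1 (PS_incr_1 c)))).
  intros k Hk. specialize (Hf k Hk).
  pose proof (is_pseries_incr_1 _ _ _ Hf) as Hf1.
  pose proof (is_pseries_incr_1 _ _ _ Hf1) as Hf2.
  evar_last.
  - apply (@is_pseries_plus R_AbsRing R_NormedModule).
    + apply is_pseries_scal with (2 := Hf). apply Rmult_comm.
    + apply (@is_pseries_plus R_AbsRing R_NormedModule) with (2 := Hf2).
      apply is_pseries_scal with (2 := Hf1). apply Rmult_comm.
  - unfold plus, scal, wsigma; simpl; unfold mult; simpl; ring.
Qed.

Lemma power_expansion_wsigma_pow n x r :
  exists c, power_expansion (fun t => wsigma t ^ n) x r c.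
Proof.
  induction n as [|n [c Hc]].
  - exists (fun n => match n with O => 1 | S _ => 0 end).
    intros k _. apply is_pseries_R.
    apply filterlim_ext with (fun _ => 1); [|apply filterlim_const].
    intros m; induction m as [|m IH].
    + rewrite sum_O. simpl. ring.
    + rewrite sum_Sn, <- IH. unfold plus; simpl. ring.
  - apply power_expansion_wsigma_mult with (1 := Hc).
Qed.

(** * The power series solution of the Pearson equation *)

(** [ode_coef x b g] lists the coefficients of the formal solution, with constant
    term 1, of [(wsigma x + 2 x k + k^2) u' = (b + g k) u].  The recurrence has
    order two, so a pair of consecutive coefficients is carried along. *)
Fixpoint ode_coef_pair (x b g : R) (n : nat) : R * R :=
  match n with
  | O => (1, b / wsigma x)
  | S n =>
      let (u, v) := ode_coef_pair x b g n in
      (v, ((b - 2 * x * INR (S n)) * v + (g - INR n) * u)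
            / (wsigma x * INR (S (S n))))
  end.

Definition ode_coef (x b g : R) (n : nat) : R := fst (ode_coef_pair x b g n).

Lemma ode_coef_SS x b g n :
  wsigma x * INR (S (S n)) * ode_coef x b g (S (S n)) =
  (b - 2 * x * INR (S n)) * ode_coef x b g (S n) + (g - INR n) * ode_coef x b g n.
Proof.
  pose proof (wsigma_pos x).
  pose proof (not_0_INR (S (S n)) (Nat.neq_succ_0 _)).
  unfold ode_coef; cbn [ode_coef_pair].
  destruct (ode_coef_pair x b g n) as [u v]; cbn [fst].
  field; split; lra.
Qed.

(** As [wsigma x + 2 x k + k^2 = (k + x - i) (k + x + i)], this is the squared
    modulus of [c_n + (x + i) c_(n+1)], the coefficient of [k^(n+1)] in
    [(k + x + i) u].  If the recurrence had constant coefficients, the remaining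
    factor [k + x - i] would make these coefficients geometric, with a ratio
    whose squared modulus is [/ wsigma x]. *)
Definition ode_energy (x b g : R) (n : nat) : R :=
  (x * ode_coef x b g (S n) + ode_coef x b g n) ^ 2 + ode_coef x b g (S n) ^ 2.

Lemma ode_energy_nonneg x b g n : 0 <= ode_energy x b g n.
Proof. apply Rplus_le_le_0_compat; apply pow2_ge_0. Qed.

(** Compared with its limit [sigma c_(n+2) = - 2 x c_(n+1) - c_n], the recurrence
    contains an error [d], which is a combination of [c_(n+1)] and [c_n] with
    coefficients of order [1/n].  The limit preserves the energy up to the factor
    [sigma], and [d] changes it by a relative amount of order [1/n]. *)
Lemma ode_energy_step x b g :
  exists C, 0 <= C /\ forall n,
    wsigma x * ode_energy x b g (S n) <= (1 + C / INR (S n)) * ode_energy x b g n.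
Proof.
  (* Once [n + 2] has been divided out, the error is [(b + 2 x) c_(n+1) + (g + 2) c_n]
     over [n + 2]; [p] and [q] are its coefficients on [v = c_(n+1)] and
     [u = x c_(n+1) + c_n], whose squares add up to the energy. *)
  set (p := b - x * g).
  set (q := g + 2).
  exists (2 * (Rabs p + Rabs q) + (Rabs p + Rabs q) ^ 2).
  pose proof (Rabs_pos p) as Hp. pose proof (Rabs_pos q) as Hq.
  split; [nra|]. intros n.
  assert (Hn : 1 <= INR (S n)) by (rewrite S_INR; pose proof (pos_INR n); lra).
  pose proof (wsigma_pos x) as Hs.
  unfold ode_energy.
  set (c2 := ode_coef x b g (S (S n))).
  set (v := ode_coef x b g (S n)).
  set (u := x * v + ode_coef x b g n).
  set (d := (p * v + q * u) / INR (S (S n))).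
  assert (Hc2 : wsigma x * c2 = - x * v - u + d).
  { apply Rmult_eq_reg_r with (INR (S (S n))); [|rewrite S_INR; lra].
    replace (wsigma x * c2 * INR (S (S n)))
      with (wsigma x * INR (S (S n)) * c2) by ring.
    unfold c2. rewrite ode_coef_SS. fold v.
    unfold d, u, p, q. rewrite (S_INR (S n)). field_simplify; [|lra]. rewrite S_INR. ring. }
  (* For [d = 0] the right-hand side is the previous energy. *)
  replace (wsigma x * ((x * c2 + v) ^ 2 + c2 ^ 2)) with (u ^ 2 + v ^ 2 - 2 * d * u + d ^ 2).
  2: { replace (wsigma x * ((x * c2 + v) ^ 2 + c2 ^ 2))
        with ((wsigma x * c2) ^ 2 + 2 * x * v * (wsigma x * c2) + wsigma x * v ^ 2)
        by (unfold wsigma; ring).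
       rewrite Hc2. unfold wsigma. ring. }
  set (N := sqrt (u ^ 2 + v ^ 2)).
  assert (HN : N ^ 2 = u ^ 2 + v ^ 2) by (unfold N; rewrite pow2_sqrt; nra).
  assert (HN0 : 0 <= N) by apply sqrt_pos.
  assert (Hu : Rabs u <= N) by (apply Rabs_le_between; split; nra).
  assert (Hv : Rabs v <= N) by (apply Rabs_le_between; split; nra).
  set (e := (Rabs p + Rabs q) / INR (S n)).
  assert (He : 0 <= e) by (apply Rdiv_le_0_compat; lra).
  assert (Hd : Rabs d <= e * N).
  { unfold d, e. rewrite Rabs_div by (rewrite (S_INR (S n)); lra).
    rewrite (Rabs_pos_eq (INR (S (S n)))) by apply pos_INR.
    replace ((Rabs p + Rabs q) / INR (S n) * N)
      with ((Rabs p + Rabs q) * N / INR (S n)) by (field; lra).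
    apply Rmult_le_compat.
    - apply Rabs_pos.
    - left; apply Rinv_0_lt_compat; rewrite (S_INR (S n)); lra.
    - eapply Rle_trans; [apply Rabs_triang|]. rewrite !Rabs_mult.
      pose proof (Rabs_pos u). pose proof (Rabs_pos v). nra.
    - apply Rinv_le_contravar; rewrite ?(S_INR (S n)); lra. }
  assert (Hdu : - d * u <= e * N ^ 2).
  { eapply Rle_trans; [apply Rle_abs|]. rewrite Rabs_mult, Rabs_Ropp.
    pose proof (Rabs_pos u). pose proof (Rabs_pos d).
    replace (e * N ^ 2) with (e * N * N) by ring.
    apply Rmult_le_compat; lra. }
  assert (Hdd : d ^ 2 <= e ^ 2 * N ^ 2).
  { rewrite <- (pow2_abs d). pose proof (Rabs_pos d).
    replace (e ^ 2 * N ^ 2) with ((e * N) ^ 2) by ring.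
    apply pow_incr; lra. }
  rewrite <- HN.
  assert (Hee : e ^ 2 <= (Rabs p + Rabs q) ^ 2 / INR (S n)).
  { unfold e. replace (((Rabs p + Rabs q) / INR (S n)) ^ 2)
      with ((Rabs p + Rabs q) ^ 2 / INR (S n) * / INR (S n)) by (field; lra).
    rewrite <- (Rmult_1_r ((Rabs p + Rabs q) ^ 2 / INR (S n))) at 2.
    apply Rmult_le_compat_l.
    - apply Rdiv_le_0_compat; nra.
    - rewrite <- Rinv_1. apply Rinv_le_contravar; lra. }
  replace ((1 + (2 * (Rabs p + Rabs q) + (Rabs p + Rabs q) ^ 2) / INR (S n)) * N ^ 2)
    with (N ^ 2 + 2 * (e * N ^ 2) + (Rabs p + Rabs q) ^ 2 / INR (S n) * N ^ 2)
    by (unfold e; field; lra).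
  assert (0 <= N ^ 2) by nra.
  nra.
Qed.

Lemma eventually_decreasing_bounded (u : nat -> R) N :
  (forall n, (N <= n)%nat -> u (S n) <= u n) -> exists M, forall n, u n <= M.
Proof.
  induction N as [|N IH]  in u |- *; intros Hu.
  - exists (u 0%nat). induction n as [|n IHn]; [lra|].
    specialize (Hu n (Nat.le_0_l n)). lra.
  - destruct (IH (fun n => u (S n))) as [M HM].
    { intros n Hn. apply Hu. lia. }
    exists (Rmax (u 0%nat) M). intros [|n].
    + apply Rmax_l.
    + apply Rle_trans with (1 := HM n), Rmax_r.
Qed.

(** The energy loses at least a factor [r^2] per step as soon as
    [1 + C / n <= wsigma x / r^2]. *)
Lemma ode_energy_growth x b g r :
  0 < r -> r ^ 2 < wsigma x ->
  exists M, forall n, r ^ (2 * n) * ode_energy x b g n <= M.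
Proof.
  intros Hr Hrs.
  destruct (ode_energy_step x b g) as [C [HC Hstep]].
  assert (Hr2 : 0 < r ^ 2) by nra.
  destruct (INR_unbounded (C * r ^ 2 / (wsigma x - r ^ 2))) as [N HN].
  apply eventually_decreasing_bounded with N. intros n Hn.
  replace (2 * S n)%nat with (2 * n + 2)%nat by lia.
  rewrite pow_add, Rmult_assoc.
  apply Rmult_le_compat_l; [apply pow_le; lra|].
  specialize (Hstep n).
  pose proof (ode_energy_nonneg x b g n) as He.
  pose proof (le_INR _ _ Hn) as Hn'.
  assert (HSn : INR n < INR (S n)) by (rewrite S_INR; lra).
  pose proof (pos_INR n).
  assert (HCn : r ^ 2 * (1 + C / INR (S n)) <= wsigma x).
  { assert (C * r ^ 2 < (wsigma x - r ^ 2) * INR (S n)).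
    { apply Rmult_lt_reg_r with (/ (wsigma x - r ^ 2)).
      - apply Rinv_0_lt_compat; lra.
      - replace ((wsigma x - r ^ 2) * INR (S n) * / (wsigma x - r ^ 2))
          with (INR (S n)) by (field; lra).
        unfold Rdiv in HN. lra. }
    apply Rmult_le_reg_r with (INR (S n)); [lra|].
    replace (r ^ 2 * (1 + C / INR (S n)) * INR (S n))
      with (r ^ 2 * INR (S n) + C * r ^ 2) by (field; lra).
    lra. }
  pose proof (wsigma_pos x).
  apply Rmult_le_reg_l with (wsigma x); [lra|].
  apply Rle_trans with (r ^ 2 * ((1 + C / INR (S n)) * ode_energy x b g n)).
  - rewrite <- Rmult_assoc, (Rmult_comm _ (r ^ 2)), Rmult_assoc.
    apply Rmult_le_compat_l; lra.
  - rewrite <- Rmult_assoc. now apply Rmult_le_compat_r.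
Qed.

Lemma CV_radius_ode_coef x b g k :
  k ^ 2 < wsigma x -> Rbar_lt (Rabs k) (CV_radius (ode_coef x b g)).
Proof.
  intros Hk.
  (* [r] lies strictly between [Rabs k] and the distance from [x] to [i]. *)
  set (R0 := sqrt (wsigma x)).
  pose proof (wsigma_pos x) as Hs.
  assert (HR : R0 ^ 2 = wsigma x) by (apply pow2_sqrt; lra).
  assert (HR0 : 0 < R0) by now apply sqrt_lt_R0.
  pose proof (Rabs_pos k) as Hk0.
  assert (HkR : Rabs k < R0).
  { rewrite <- (pow2_abs k) in Hk. nra. }
  set (r := (Rabs k + R0) / 2).
  assert (Hr : Rabs k < r < R0) by (unfold r; lra).
  apply Rbar_lt_le_trans with r; [simpl; lra|].
  apply CV_radius_bounded.
  destruct (ode_energy_growth x b g r) as [M HM]; [lra|nra|].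
  (* A number whose square is at most [M] is itself at most [1 + M]. *)
  exists (Rmax 1 (r * (1 + M))). intros [|n].
  - unfold ode_coef; simpl. rewrite Rmult_1_r, Rabs_R1. apply Rmax_l.
  - apply Rle_trans with (2 := Rmax_r _ _).
    replace (ode_coef x b g (S n) * r ^ S n)
      with (r * (ode_coef x b g (S n) * r ^ n)) by (simpl; ring).
    rewrite Rabs_mult, (Rabs_pos_eq r) by lra.
    apply Rmult_le_compat_l; [lra|].
    specialize (HM n).
    assert (Hsq : (ode_coef x b g (S n) * r ^ n) ^ 2 <= M).
    { apply Rle_trans with (2 := HM).
      rewrite Rpow_mult_distr, <- pow_mult, (Nat.mul_comm n 2), Rmult_comm.
      apply Rmult_le_compat_l; [apply pow_le; lra|].
      unfold ode_energy.
      pose proof (pow2_ge_0 (x * ode_coef x b g (S n) + ode_coef x b g n)). lra. }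
    apply Rabs_le_between. split; nra.
Qed.

(** The recurrence is this equation read coefficient by coefficient. *)
Lemma ode_coef_ode x b g k :
  k ^ 2 < wsigma x ->
  wsigma (x + k) * PSeries (PS_derive (ode_coef x b g)) k =
  (b + g * k) * PSeries (ode_coef x b g) k.
Proof.
  intros Hk.
  set (c := ode_coef x b g).
  assert (Hc : Rbar_lt (Rabs k) (CV_radius c)) by now apply CV_radius_ode_coef.
  assert (Ec : ex_pseries c k) by now apply CV_radius_inside.
  assert (Ed : ex_pseries (PS_derive c) k)
    by (apply CV_radius_inside; now rewrite CV_radius_derive).
  assert (H : PSeries (PS_plus (PS_scal (wsigma x) (PS_derive c))
                (PS_plus (PS_scal (2 * x) (PS_incr_1 (PS_derive c)))
                   (PS_incr_1 (PS_incr_1 (PS_derive c))))) k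
            = PSeries (PS_plus (PS_scal b c) (PS_scal g (PS_incr_1 c))) k).
  { apply PSeries_ext. intros n.
    pose proof (wsigma_pos x).
    unfold PS_plus, PS_scal, PS_derive.
    destruct n as [|[|n]]; cbn [PS_incr_1];
      unfold plus, scal, zero; cbn -[INR]; unfold mult; cbn -[INR];
      match goal with |- ?u = ?v => change (@eq R u v) end.
    - unfold c, ode_coef; simpl. field. lra.
    - unfold c, ode_coef; simpl. field. lra.
    - pose proof (ode_coef_SS x b g (S n)) as E. fold c in E.
      rewrite !S_INR in *. lra. }
  assert (Es : forall (s : R) (d : nat -> R), ex_pseries d k -> ex_pseries (PS_scal s d) k)
    by (intros s d; apply (ex_pseries_scal s d k), Rmult_comm).
  assert (Ed1 : ex_pseries (PS_incr_1 (PS_derive c)) k)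
    by now apply (ex_pseries_incr_1 (PS_derive c)).
  assert (Ed2 : ex_pseries (PS_incr_1 (PS_incr_1 (PS_derive c))) k)
    by now apply (ex_pseries_incr_1 (PS_incr_1 (PS_derive c))).
  assert (Ec1 : ex_pseries (PS_incr_1 c) k) by now apply (ex_pseries_incr_1 c).
  rewrite (PSeries_plus (PS_scal b c) _ _ (Es b c Ec) (Es g _ Ec1)) in H.
  rewrite (PSeries_plus (PS_scal (wsigma x) (PS_derive c)) _ _ (Es _ _ Ed)
             (ex_pseries_plus _ _ _ (Es (2 * x) _ Ed1) Ed2)) in H.
  rewrite (PSeries_plus _ _ _ (Es (2 * x) _ Ed1) Ed2) in H.
  rewrite !PSeries_scal, !PSeries_incr_1 in H.
  unfold wsigma in *. lra.
Qed.

(** The quotient of two solutions of [y' = h y] has derivative zero. *)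
Lemma linear_ode_unique (h u v : R -> R) r k :
  (forall t, Rabs t < r -> is_derive u t (h t * u t)) ->
  (forall t, Rabs t < r -> is_derive v t (h t * v t)) ->
  (forall t, Rabs t < r -> v t <> 0) ->
  Rabs k < r -> u k / v k = u 0 / v 0.
Proof.
  intros Hu Hv Hv0 Hk.
  assert (Hd : forall t, Rabs t < r -> is_derive (fun t => u t / v t) t 0).
  { intros t Ht. evar_last.
    - apply is_derive_div; [now apply Hu | now apply Hv | now apply Hv0].
    - field. now apply Hv0. }
  assert (Hin : forall t, Rmin 0 k <= t <= Rmax 0 k -> Rabs t < r).
  { intros t Ht. apply Rle_lt_trans with (2 := Hk).
    revert Ht. unfold Rmin, Rmax, Rabs.
    destruct Rle_dec; destruct Rcase_abs; destruct Rcase_abs; lra. }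
  destruct (MVT_gen (fun t => u t / v t) 0 k (fun _ => 0)) as [z [_ Hz]].
  - intros t Ht. apply Hd, Hin. lra.
  - intros t Ht. apply continuity_pt_filterlim, (ex_derive_continuous (fun t => u t / v t)).
    exists 0. now apply Hd, Hin.
  - lra.
Qed.

(** * Expansion of the weight *)

Lemma weight_pos a alpha l x : 0 < weight a alpha l x.
Proof. apply Rmult_lt_0_compat; apply exp_pos. Qed.

Lemma Rpower_wsigma_sub s n t :
  Rpower (wsigma t) (s - INR n) = Rpower (wsigma t) s / wsigma t ^ n.
Proof.
  unfold Rminus. rewrite Rpower_plus, Rpower_Ropp, Rpower_pow by apply wsigma_pos.
  reflexivity.
Qed.

Lemma weight_factor a alpha l x :
  weight a alpha l x = weight a alpha 0 x / wsigma x ^ l.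
Proof.
  unfold weight.
  replace (- (INR l + a + 1)) with (- (INR 0 + a + 1) - INR l) by (simpl; ring).
  rewrite Rpower_wsigma_sub. unfold Rdiv. ring.
Qed.

(** The Pearson equation of the weight. *)
Lemma is_derive_weight a alpha x :
  is_derive (weight a alpha 0) x
    ((alpha - 2 * (a + 1) * x) / wsigma x * weight a alpha 0 x).
Proof.
  pose proof (wsigma_pos x) as Hs.
  unfold weight, arccot, Rpower, wsigma in *. simpl INR.
  auto_derive.
  - repeat split; lra.
  - replace (x * (x * 1)) with (x ^ 2) by (simpl; ring).
    change (PI / 2 + - atan x) with (PI / 2 - atan x). field. lra.
Qed.

(** Both [w_0 (x + k)] and the power series solution satisfy the Pearson equation
    moved to the origin, so they are proportional, and [k = 0] gives the factor
    [w_0 x]. *)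
Lemma power_expansion_weight a alpha x r :
  r ^ 2 < wsigma x -> exists c, power_expansion (weight a alpha 0) x r c.
Proof.
  intros Hr.
  set (b := alpha - 2 * (a + 1) * x). set (g := - 2 * (a + 1)).
  exists (PS_scal (weight a alpha 0 x) (ode_coef x b g)).
  intros k Hk.
  assert (Hin : forall t, Rabs t < r -> t ^ 2 < wsigma x).
  { intros t Ht. rewrite <- (pow2_abs t). pose proof (Rabs_pos t). nra. }
  pose proof (linear_ode_unique (fun t => (b + g * t) / wsigma (x + t))
    (PSeries (ode_coef x b g)) (fun t => weight a alpha 0 (x + t)) r k) as Huniq.
  replace (weight a alpha 0 (x + k))
    with (weight a alpha 0 x * PSeries (ode_coef x b g) k).
  - apply (is_pseries_scal (weight a alpha 0 x) (ode_coef x b g) k).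
    + apply Rmult_comm.
    + apply PSeries_correct, CV_radius_inside, CV_radius_ode_coef, Hin, Hk.
  - pose proof (weight_pos a alpha 0 x). pose proof (weight_pos a alpha 0 (x + k)).
    apply Rmult_eq_reg_r with (/ weight a alpha 0 (x + k) * / weight a alpha 0 x).
    2: { apply Rgt_not_eq, Rmult_lt_0_compat; now apply Rinv_0_lt_compat. }
    replace (weight a alpha 0 (x + k) * (/ weight a alpha 0 (x + k) * / weight a alpha 0 x))
      with (1 / weight a alpha 0 x) by (field; lra).
    rewrite PSeries_0, Rplus_0_r in Huniq. change (ode_coef x b g 0) with 1 in Huniq.
    rewrite <- Huniq; try assumption.
    + field; lra.
    + intros t Ht. pose proof (wsigma_pos (x + t)).
      evar_last.
      * apply is_derive_PSeries, CV_radius_ode_coef, Hin, Ht.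
      * apply Rmult_eq_reg_l with (wsigma (x + t)); [|lra].
        rewrite (ode_coef_ode x b g t) by now apply Hin. field. lra.
    + intros t Ht. pose proof (wsigma_pos (x + t)).
      evar_last.
      * apply (is_derive_comp (weight a alpha 0) (fun t => x + t)).
        -- apply is_derive_weight.
        -- auto_derive; [trivial|reflexivity].
      * unfold scal; simpl; unfold mult; simpl. unfold b, g. field. lra.
    + intros t Ht. apply Rgt_not_eq, weight_pos.
Qed.

Lemma power_expansion_ext f g x r c :
  (forall t, f t = g t) -> power_expansion f x r c -> power_expansion g x r c.
Proof. intros Hfg Hf k Hk. rewrite <- Hfg. now apply Hf. Qed.

(** The point [i] is at distance [sqrt (wsigma x)] from [x].  Either the closed disc
    of radius [Rabs (y * wsigma x)] misses it, and the expansion reaches a little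
    beyond the disc, or regularity at [i] forces the weight to be a polynomial. *)
Lemma regular_displacement_expansion a alpha x y :
  regular_displacement a alpha x y ->
  exists r c, Rabs (y * wsigma x) < r /\ power_expansion (weight a alpha 0) x r c.
Proof.
  intros Hreg. set (h := y * wsigma x).
  assert (HC : Cmod (Ci - RtoC x)%C = sqrt (wsigma x)).
  { unfold Cmod, wsigma; simpl. f_equal. ring. }
  pose proof (wsigma_pos x) as Hs.
  destruct (Rle_lt_dec (sqrt (wsigma x)) (Rabs h)) as [Hle | Hlt].
  - destruct (Hreg Ci) as [Hne | [Halpha [n Hn]]].
    + rewrite HC. exact Hle.
    + exfalso. apply Hne. unfold Ci, Cmult, Cplus, RtoC. simpl. f_equal; ring.
    + destruct (power_expansion_wsigma_pow n x (Rabs h + 1)) as [c Hc].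
      exists (Rabs h + 1), c. split; [lra|].
      apply power_expansion_ext with (2 := Hc). intros t.
      unfold weight. rewrite Halpha.
      replace (- (INR 0 + a + 1)) with (INR n) by (simpl; lra).
      rewrite Rpower_pow by apply wsigma_pos.
      replace (- 0 * arccot t) with 0 by ring. rewrite exp_0. ring.
  - set (r := (Rabs h + sqrt (wsigma x)) / 2).
    assert (Hr2 : r ^ 2 < wsigma x).
    { rewrite <- (pow2_sqrt (wsigma x)) by lra. unfold r.
      pose proof (Rabs_pos h). nra. }
    destruct (power_expansion_weight a alpha x r Hr2) as [c Hc].
    exists r, c. split; [unfold r; lra | exact Hc].
Qed.

(** * The complementary polynomials *)

Lemma complementary_Derive_n a alpha Q nu x :
  is_complementary a alpha Q ->
  Q nu x = wsigma x ^ nu / weight a alpha 0 x * Derive_n (weight a alpha 0) nu x.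
Proof.
  intros [_ HQ].
  pose proof (weight_pos a alpha 0 x). pose proof (weight_pos a alpha nu x).
  pose proof (wsigma_pos x).
  specialize (HQ nu nu x (le_n _)). unfold romanovski_P in HQ.
  rewrite Nat.sub_diag in HQ. simpl Derive_n in HQ at 2.
  apply Rmult_eq_reg_l in HQ; [|apply Rinv_neq_0_compat; lra].
  rewrite (Derive_n_ext _ (weight a alpha 0)) in HQ.
  - rewrite HQ, (weight_factor a alpha nu). simpl. field.
    split; [apply pow_nonzero|]; lra.
  - intros t. pose proof (wsigma_pos t). rewrite weight_factor. field.
    apply pow_nonzero; lra.
Qed.

(** The function under the derivatives of the last two formulas is itself a
    derivative of [w_0], so those formulas concern the same Taylor series. *)
Lemma weight_mul_complementary a alpha Q mu t :
  is_complementary a alpha Q ->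
  Rpower (wsigma t) (- (a + INR mu + 1)) * exp (- alpha * arccot t) * Q mu t
  = Derive_n (weight a alpha 0) mu t.
Proof.
  intros HQ. rewrite (complementary_Derive_n a alpha Q) by assumption.
  pose proof (wsigma_pos t). pose proof (weight_pos a alpha 0 t).
  replace (Rpower (wsigma t) (- (a + INR mu + 1)) * exp (- alpha * arccot t))
    with (weight a alpha mu t) by (unfold weight; do 3 f_equal; ring).
  rewrite weight_factor. field. split; [lra|apply pow_nonzero; lra].
Qed.

(** * The generating function *)

Theorem theorem1p6 (alpha a : R) (l mu : nat) (Q : nat -> R -> R)
    (hQ : is_complementary a alpha Q)
    (x y : R) (hreg : regular_displacement a alpha x y) :
  (ex_series (fun nu => y ^ nu / INR (fact nu) * Q nu x)
   /\
   ex_series (fun nu =>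
     (y * wsigma x) ^ nu / INR (fact nu)
     * Derive_n (fun t => Rpower (wsigma t) (- (a + 1)) * exp (- alpha * arccot t))
                nu x)
   /\
   ex_series (from mu (fun nu =>
     (y * wsigma x) ^ (nu - mu) / INR (fact (nu - mu))
     * Derive_n (fun t => Rpower (wsigma t) (- (a + INR mu + 1))
                          * exp (- alpha * arccot t) * Q mu t)
                (nu - mu) x)))
  /\
  weight a alpha l x * generating_function Q x y =
    / wsigma x ^ l
    * Series (fun nu =>
        (y * wsigma x) ^ nu / INR (fact nu)
        * Derive_n (fun t => Rpower (wsigma t) (- (a + 1)) * exp (- alpha * arccot t))
                   nu x)
  /\
  generating_function Q x y =
    Rpower (1 + x ^ 2) (a + 1) * exp (alpha * arccot x)
    * Rpower (1 + (x + y * (1 + x ^ 2)) ^ 2) (- (a + 1))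
    * exp (- alpha * arccot (x + y * (1 + x ^ 2)))
  /\
  is_derive_n (fun y' => weight a alpha l x * wsigma x ^ l * generating_function Q x y')
    mu y
    (wsigma x ^ mu
     * Series (from mu (fun nu =>
         (y * wsigma x) ^ (nu - mu) / INR (fact (nu - mu))
         * Derive_n (fun t => Rpower (wsigma t) (- (a + INR mu + 1))
                              * exp (- alpha * arccot t) * Q mu t)
                    (nu - mu) x)))
  /\
  is_derive_n (fun y' => generating_function Q x y') mu y
    (/ weight a alpha l x
     * powerRZ (wsigma x) (Z.of_nat mu - Z.of_nat l)
     * Rpower (1 + (x + y * wsigma x) ^ 2) (- (a + INR mu + 1))
     * exp (- alpha * arccot (x + y * wsigma x))
     * Q mu (x + y * wsigma x)).
Proof.
  destruct (regular_displacement_expansion a alpha x y hreg) as [r [c [Hr Hc]]].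
  pose proof (weight_pos a alpha 0 x) as Hw. pose proof (wsigma_pos x) as Hs.
  assert (Hsl : wsigma x ^ l <> 0) by (apply pow_nonzero; lra).
  set (W := weight a alpha 0) in *.
  assert (Hw0 : forall t, Rpower (wsigma t) (- (a + 1)) * exp (- alpha * arccot t) = W t).
  { intros t. unfold W, weight. simpl INR. now rewrite Rplus_0_l. }
  assert (Hgen : forall y', Rabs (y' * wsigma x) < r ->
            is_series (fun nu => y' ^ nu / INR (fact nu) * Q nu x)
              (/ W x * W (x + y' * wsigma x))).
  { intros y' Hy'.
    apply is_series_ext with (fun n => / W x *
       ((y' * wsigma x) ^ n / INR (fact n) * Derive_n W (n + 0) x)).
    - intros n. rewrite Nat.add_0_r, (complementary_Derive_n a alpha Q) by exact hQ.
      fold W. rewrite Rpow_mult_distr.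
      match goal with |- ?u = ?v => change (@eq R u v) end.
      field. split; [lra|apply INR_fact_neq_0].
    - apply (@is_series_scal_l R_AbsRing R_NormedModule (/ W x)).
      exact (taylor_series_Derive_n W x r c 0 _ Hc Hy'). }
  assert (Hfrom : is_series (from mu (fun nu =>
       (y * wsigma x) ^ (nu - mu) / INR (fact (nu - mu))
       * Derive_n (fun t => Rpower (wsigma t) (- (a + INR mu + 1))
                            * exp (- alpha * arccot t) * Q mu t)
                  (nu - mu) x)) (Derive_n W mu (x + y * wsigma x))).
  { apply is_series_ext with (2 := taylor_series_Derive_n W x r c mu _ Hc Hr).
    intros n. unfold from. replace (mu + n - mu)%nat with n by lia. f_equal.
    rewrite <- Derive_n_comp. apply Derive_n_ext. intros t. symmetry.
    now apply weight_mul_complementary. }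
  assert (Htay : is_series (fun nu => (y * wsigma x) ^ nu / INR (fact nu)
        * Derive_n (fun t => Rpower (wsigma t) (- (a + 1)) * exp (- alpha * arccot t))
                   nu x) (W (x + y * wsigma x))).
  { apply is_series_ext with (2 := taylor_series_Derive_n W x r c 0 _ Hc Hr).
    intros n. rewrite Nat.add_0_r. f_equal. apply Derive_n_ext.
    intros t. symmetry. apply Hw0. }
  assert (Hder : is_derive_n (fun y' => generating_function Q x y') mu y
            (/ W x * (wsigma x ^ mu * Derive_n W mu (x + y * wsigma x)))).
  { apply is_derive_n_ext_loc with (fun y' => / W x * W (x + y' * wsigma x)).
    - assert (Hcont : continuous (fun y' : R => y' * wsigma x) y)
        by apply (continuous_scal_l (fun y' : R => y') (wsigma x)), continuous_id.
      apply (filter_imp (fun y' => Rabs (y' * wsigma x) < r)).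
      + intros y' Hy'. symmetry. now apply is_series_unique, Hgen.
      + exact (Hcont (fun t => Rabs t < r) (locally_Rabs_lt _ _ Hr)).
    - apply is_derive_n_scal_l. now apply is_derive_n_rescaled with (1 := Hc). }
  repeat apply conj.
  - eexists. apply Hgen, Hr.
  - eexists. exact Htay.
  - eexists. exact Hfrom.
  - unfold generating_function.
    rewrite (is_series_unique _ _ Htay), (is_series_unique _ _ (Hgen y Hr)), weight_factor.
    fold W. field. split; (exact Hsl || lra).
  - unfold generating_function. rewrite (is_series_unique _ _ (Hgen y Hr)).
    fold (wsigma x) (wsigma (x + y * wsigma x)).
    rewrite Rmult_assoc, Hw0. f_equal.
    rewrite <- Hw0, Rinv_mult, <- Rpower_Ropp, <- exp_Ropp. f_equal; f_equal; ring.
  - rewrite (is_series_unique _ _ Hfrom).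
    evar_last; [apply is_derive_n_scal_l, Hder|].
    rewrite weight_factor. fold W. field. split; (exact Hsl || lra).
  - evar_last; [exact Hder|].
    fold (wsigma (x + y * wsigma x)).
    rewrite !Rmult_assoc.
    rewrite <- (Rmult_assoc (Rpower _ _)), weight_mul_complementary by exact hQ.
    unfold Zminus. rewrite powerRZ_add, powerRZ_neg', <- !pow_powerRZ by lra.
    rewrite weight_factor. fold W. field. split; (exact Hsl || lra).
Qed.
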